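(* Let $n \ge 0$ be an integer and let $\mathcal{G}$ be a finite connected graph of groups such that every vertex group of $\mathcal{G}$ has geometric rank less than or equal to $n$. Then the geometric rank of $\pi_1(\mathcal{G})$ is less than or equal to $n+1$.
   Context: The geometric rank of a group $G$ is the largest $n$ such that $\mathbb{Z}^n$ embeds in $G$ (i.e. is isomorphic to a subgroup of $G$). An abstract graph $\Gamma$ is a pair of sets $V$ (vertices) and $E$ (edges) together with a fixed-point-free involution $e \mapsto \overline{e}$ on $E$ and a map $\partial_0 : E \to V$; put $\partial_1 e = \partial_0 \overline{e}$. The associated ordinary graph has vertex set $V$ and one edge joining $\partial_0 e$ to $\partial_1 e$ for each pair $\{e,\overline{e}\}$; $\Gamma$ is connected if this ordinary graph is connected. All underlying graphs are assumed finite, (non-empty) and connected. Loops and multiple edges are allowed. A graph of groups $\mathcal{G}$ is an abstract graph $\Gamma$ together with a group $G_v$ (vertex group) for each $v\in V$, a group $G_e$ (edge group) for each $e \in E$ with $G_e = G_{\overline{e}}$, and an injective homomorphism $f_e : G_e \to G_{\partial_0 e}$ (edge map) for each $e\in E$. The fundamental group $\pi_1(\mathcal{G})$ is the fundamental group of the total space obtained as follows: choose based path-connected spaces $X_v$, $X_e$ (with $X_e = X_{\overline e}$) and based maps $X_e \to X_{\partial_0 e}$ realizing $G_v$, $G_e$, $f_e$ on fundamental groups, and take the quotient of the disjoint union of all $X_v$ and all $X_e\times[0,1]$ by identifying $(x,t)\in X_e\times [0,1]$ with $(x,1-t)\in X_{\overline{e}}\times[0,1]$ and $(x,0)\in X_e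 \times [0,1]$ with its image in $X_{\partial_0 e}$. Equivalently, for a maximal tree $T$ of $\Gamma$, $\pi_1(\mathcal{G})$ is the group generated by all the groups $G_v$ and symbols $t_e$ ($e\in E$) subject to the relations $t_{\overline{e}} = t_e^{-1}$, $t_e f_{\overline{e}}(g) t_e^{-1} = f_e(g)$ for all $e \in E$, $g\in G_e$, and $t_e = 1$ for $e$ in $T$. Up to isomorphism it does not depend on the choices. *)

(* Defs.v *)
From HB Require Import structures.
From mathcomp Require Import all_boot all_algebra.
From mathcomp Require Import boolp.

Set Implicit Arguments.
Unset Strict Implicit.
Unset Printing Implicit Defensive.

Local Open Scope quotient_scope.

(* Z^k, written additively as row vectors, is isomorphic to a subgroup of G. *)
Definition Zn_embeds (k : nat) (G : groupType) : Prop :=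
  exists f : 'rV[int]_k -> G,
    injective f /\ forall x y, f (x + y)%R = (f x * f y)%g.

(* A relation rather than a function: G has no (finite) geometric rank when
   Z^k embeds in G for arbitrarily large k. *)
Definition geometric_rank (G : groupType) (r : nat) : Prop :=
  Zn_embeds r G /\ forall k, Zn_embeds k G -> (k <= r)%N.

(* The letter (x, false) stands for x and (x, true) for its inverse. *)
Definition word (X : Type) := seq (X * bool).

Definition winv (X : Type) (w : word X) : word X :=
  rev [seq (a.1, ~~ a.2) | a <- w].

Inductive pres_eq (X : Type) (R : word X -> word X -> Prop) :
    word X -> word X -> Prop :=
| PresRefl w : pres_eq R w w
| PresSym u w : pres_eq R u w -> pres_eq R w u
| PresTrans u v w : pres_eq R u v -> pres_eq R v w -> pres_eq R u w
| PresCat u u' w w' :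
    pres_eq R u u' -> pres_eq R w w' -> pres_eq R (u ++ w) (u' ++ w')
| PresCancel x b : pres_eq R [:: (x, b); (x, ~~ b)] [::]
| PresRel u w : R u w -> pres_eq R u w.

Section Presentation.
Variables (X : choiceType) (R : word X -> word X -> Prop).

Definition pres_rel : rel (word X) := fun u w => `[< pres_eq R u w >].

Lemma pres_rel_refl : reflexive pres_rel.
Proof. by move=> w; apply/asboolP/PresRefl. Qed.

Lemma pres_rel_sym : symmetric pres_rel.
Proof. by move=> u w; apply/asboolP/asboolP => /PresSym. Qed.

Lemma pres_rel_trans : transitive pres_rel.
Proof.
by move=> v u w /asboolP uv /asboolP vw; apply/asboolP; apply: PresTrans vw.
Qed.

Canonical pres_equiv :=
  EquivRel pres_rel pres_rel_refl pres_rel_sym pres_rel_trans.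

(* The group <X | u = w for R u w>. *)
Definition presented : Type := {eq_quot pres_equiv}.
HB.instance Definition _ := EqQuotient.on presented.
HB.instance Definition _ := Choice.on presented.

Lemma pres_eqP (u w : word X) :
  pres_eq R u w <-> \pi_presented u = \pi_presented w.
Proof.
by split=> [uw | /eqmodP/asboolP //]; apply/eqmodP/asboolP.
Qed.

Lemma pres_eq_winvl (v : word X) : pres_eq R (winv v ++ v) [::].
Proof.
elim: v => [|[x b] v IH]; first exact: PresRefl.
rewrite /winv /= rev_cons cat_rcons -/(winv v).
apply: PresTrans IH; apply: PresCat; first exact: PresRefl.
rewrite -[_ :: _]/([:: (x, ~~ b); (x, b)] ++ v) -[X in pres_eq R _ X]cat0s.
apply: PresCat; last exact: PresRefl.
by rewrite -[in (x, b)](negbK b); exact: PresCancel.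
Qed.

Lemma winvK : involutive (@winv X).
Proof.
move=> v; rewrite /winv map_rev revK -map_comp -[RHS]map_id.
by apply: eq_map => -[x b] /=; rewrite negbK.
Qed.

Lemma pres_eq_winvr (v : word X) : pres_eq R (v ++ winv v) [::].
Proof. by rewrite -{1}[v]winvK; exact: pres_eq_winvl. Qed.

Lemma pres_eq_winv (u w : word X) :
  pres_eq R u w -> pres_eq R (winv u) (winv w).
Proof.
move=> uw; rewrite -[winv u]cats0.
apply: PresTrans (PresCat (PresRefl _ _) (PresSym (pres_eq_winvr w))) _.
rewrite catA -[X in pres_eq R _ X]cat0s; apply: PresCat; last exact: PresRefl.
apply: PresTrans (pres_eq_winvl u).
by apply: PresCat; [exact: PresRefl | exact: PresSym].
Qed.

Definition pres_one : presented := \pi_presented [::].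
Definition pres_mul : presented -> presented -> presented :=
  lift_op2 presented (@cat (X * bool)).
Definition pres_inv : presented -> presented := lift_op1 presented (@winv X).

Lemma pres_mulE (u w : word X) :
  pres_mul (\pi_presented u) (\pi_presented w) = \pi_presented (u ++ w).
Proof.
unlock pres_mul; apply/pres_eqP.
by apply: PresCat; apply/pres_eqP; rewrite reprK.
Qed.

Lemma pres_invE (u : word X) :
  pres_inv (\pi_presented u) = \pi_presented (winv u).
Proof.
by unlock pres_inv; apply/pres_eqP/pres_eq_winv/pres_eqP; rewrite reprK.
Qed.

Lemma pres_mulA : associative pres_mul.
Proof.
by move=> x y z; rewrite -[x]reprK -[y]reprK -[z]reprK !pres_mulE catA.
Qed.

Lemma pres_mul1 : left_id pres_one pres_mul.
Proof. by move=> x; rewrite -[x]reprK pres_mulE. Qed.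

Lemma pres_mulr1 : right_id pres_one pres_mul.
Proof. by move=> x; rewrite -[x]reprK pres_mulE cats0. Qed.

Lemma pres_mulV : left_inverse pres_one pres_inv pres_mul.
Proof.
by move=> x; rewrite -[x]reprK pres_invE pres_mulE; apply/pres_eqP/pres_eq_winvl.
Qed.

Lemma pres_mulrV : right_inverse pres_one pres_inv pres_mul.
Proof.
by move=> x; rewrite -[x]reprK pres_invE pres_mulE; apply/pres_eqP/pres_eq_winvr.
Qed.

HB.instance Definition _ := isGroup.Build presented
  pres_mulA pres_mul1 pres_mulr1 pres_mulV pres_mulrV.

End Presentation.

Record agraph := AGraph {
  vertex : finType;
  edge : finType;
  bar : edge -> edge;
  barK : involutive bar;
  bar_neq : forall e, bar e != e;
  d0 : edge -> vertex
}.

Definition d1 (Gamma : agraph) (e : edge Gamma) : vertex Gamma := d0 (bar e).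

Section Graph.
Variable Gamma : agraph.
Implicit Types (T : {set edge Gamma}) (e : edge Gamma).

Definition adj T : rel (vertex Gamma) :=
  [rel x y | [exists e in T, (d0 e == x) && (d1 e == y)]].

Definition connected_graph : Prop :=
  (0 < #|vertex Gamma|)%N /\ forall x y, connect (adj [set: edge Gamma]) x y.

(* A circuit: a non-empty closed edge path without backtracking that visits
   each of its vertices once (a loop is a circuit of length 1). *)
Definition circuit (p : seq (edge Gamma)) : bool :=
  [&& p != [::],
      cycle [rel e e' | (d1 e == d0 e') && (e' != bar e)] p
    & uniq (map (@d0 Gamma) p)].

(* The edge set of a tree containing every vertex; in a connected graph these
   are the maximal trees. *)
Definition maximal_tree T : Prop :=
  [/\ forall e, e \in T -> bar e \in T,
      forall x y, connect (adj T) x y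
    & forall p, {subset p <= T} -> ~~ circuit p].

Lemma maximal_tree_exists :
  connected_graph -> exists T : {set edge Gamma}, maximal_tree T.
Proof.
case=> _ conn.
pose P (T : {set edge Gamma}) := [forall e in T, bar e \in T] &&
            [forall x, forall y, connect (adj T) x y].
have PT : P setT.
  apply/andP; split; first by apply/forall_inP => e _; rewrite inE.
  by apply/forallP => x; apply/forallP.
case: (@arg_minnP _ setT P (fun T => #|T|) PT) => T /andP[/forall_inP Tbar].
move=> /forallP Tconn Tmin; exists T; split=> // [x y|p pT].
  by have /forallP := Tconn x.
apply/negP; case: p pT => [|e p] pT /and3P[] // _.
rewrite [cycle _ _]/= rcons_path => /andP[pp /andP[/eqP le _]] /andP[ep up].
have eT : e \in T by apply: pT; rewrite mem_head.
pose T' := T :\ e :\ bar e.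
have barT' f : f \in T' -> bar f \in T'.
  rewrite !inE => /and3P[fb fe fT]; rewrite Tbar // andbT.
  rewrite (inj_eq (can_inj (@barK _))) fe /=.
  by apply: contra fb => /eqP<-; rewrite barK.
have sym' : connect_sym (adj T').
  apply: sym_connect_sym => x y.
  by apply/exists_inP/exists_inP => -[f fT /andP[/eqP f0 /eqP f1]];
    exists (bar f); rewrite ?barT' // -f0 -f1 /d1 barK !eqxx.
have pT' : {subset p <= T'}.
  move=> f fp; rewrite !inE pT ?inE ?fp ?orbT // andbT; apply/andP; split.
    apply/eqP => fE; case: p {le pT} pp ep up fp => // e2 p.
    rewrite /= fE => /andP[/andP[/eqP e12 e2e] _] _ /andP[e2p _].
    rewrite inE eq_sym (negPf e2e) /= => bp.
    by move: e2p; rewrite -e12; apply/negP; rewrite negbK; apply: map_f bp.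
  by apply/eqP => fE; move: ep; rewrite -fE map_f.
have key : connect (adj T') (d1 e) (d0 e).
  rewrite -le; elim: p (e) pp pT' {ep up le pT} => [|f p IH] e' //=.
  move=> /andP[/andP[/eqP e'f _] pp] pT'.
  apply: (connect_trans (y := d1 f)).
    by apply/connect1/exists_inP; exists f; rewrite ?pT' ?mem_head // e'f !eqxx.
  by apply: IH => // g gp; apply: pT'; rewrite inE gp orbT.
have : P T'.
  apply/andP; split; first exact/forall_inP.
  apply/forallP => x; apply/forallP => y; have /forallP/(_ y) := Tconn x.
  apply: connect_sub => {}x {}y /exists_inP[f fT /andP[/eqP<- /eqP<-]].
  have [->|fe] := eqVneq f e; first by rewrite sym'.
  have [->|fb] := eqVneq f (bar e); first by rewrite /d1 barK.
  by apply/connect1/exists_inP; exists f; rewrite ?inE ?fe ?fb ?eqxx.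
move=> /Tmin; apply/negP; rewrite -ltnNge; apply: proper_card.
apply/properP; split; first by rewrite /T' !subDset; apply/subsetP => f;
  rewrite !inE => ->; rewrite !orbT.
by exists e => //; rewrite !inE eqxx andbF.
Qed.

End Graph.

Record graph_of_groups := GraphOfGroups {
  ugraph : agraph;
  vgroup : vertex ugraph -> groupType;
  egroup : edge ugraph -> groupType;
  egroup_bar : forall e, egroup e = egroup (bar e);
  emap : forall e, {multiplicative egroup e -> vgroup (d0 e)};
  emap_inj : forall e, injective (emap e)
}.

Section FundamentalGroup.
Variable GG : graph_of_groups.
Local Notation V := (vertex (ugraph GG)).
Local Notation E := (edge (ugraph GG)).

(* g : G_e seen as an element of the same group G_(bar e). *)
Definition to_bar (e : E) (g : egroup e) : egroup (bar e) :=
  ecast G (G : groupType) (egroup_bar e) g.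

(* inl (Tagged _ g) is the element g of a vertex group, inr e is t_e. *)
Definition pi1_gen : choiceType := ({v : V & vgroup v} + E)%type.

Definition wv (v : V) (g : vgroup v) : word pi1_gen :=
  [:: (inl (Tagged (fun v => vgroup v) g), false)].
Definition wt (e : E) : word pi1_gen := [:: (inr e, false)].

Inductive pi1_relation (T : {set E}) : word pi1_gen -> word pi1_gen -> Prop :=
| Pi1Mul v (g h : vgroup v) :
    pi1_relation T (wv g ++ wv h) (wv (g * h)%g)
| Pi1Bar e : pi1_relation T (wt (bar e)) (winv (wt e))
| Pi1Conj e (g : egroup e) :
    pi1_relation T (wt e ++ wv (emap (bar e) (to_bar g)) ++ winv (wt e))
                   (wv (emap e g))
| Pi1Tree e : e \in T -> pi1_relation T (wt e) [::].

(* The fundamental group computed with the maximal tree T. *)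
Definition pi1 (T : {set E}) : groupType := presented (pi1_relation T).

End FundamentalGroup.

(* Main.v *)
(* The group acts on its Bass-Serre tree, whose vertex stabilizers are conjugates
   of the (faithfully embedded) vertex groups. Let A = Z^k act. If every element
   of 2A has a fixed vertex, then 2A fixes a vertex, so Z^k embeds in a vertex
   group. Otherwise some h in 2A is hyperbolic; as A commutes with h it preserves
   the axis of h, and every a in A has a positive multiple which moves a given
   vertex x of the axis as a power of h does. These relations yield k - 1
   independent elements fixing x, so Z^(k-1) embeds in a vertex group. Squares
   are used only to have even displacements, hence no inversions.

   The tree enters through its distance only, on the vertices (x, v), read as
   x G_v. This distance comes from reduced words in a multiple HNN extension of
   the product of all vertex groups. *)

From HB Require Import structures.
Require Import Defs.
From mathcomp Require Import all_boot all_algebra.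
From mathcomp Require Import boolp.
From mathcomp Require Import zify.

Set Implicit Arguments.
Unset Strict Implicit.
Unset Printing Implicit Defensive.

Import GRing.Theory Num.Theory.

(** * Abelian groups acting on trees, in terms of the distance *)

Section PseudoTree.
Variables (P : Type) (d : P -> P -> nat).

(* [P] is the vertex set of a tree up to points at distance 0. The third clause
   (the four-point condition) is 0-hyperbolicity; the fourth excludes triangles
   of odd perimeter, which 0-hyperbolicity allows in a graph. *)
Record pseudo_tree : Prop := PseudoTree {
  dist_xx : forall x, d x x = 0;
  distC : forall x y, d x y = d y x;
  dist_four_point : forall x y z w,
    d x y + d z w <= maxn (d x z + d y w) (d x w + d y z);
  dist_perimeter : forall x y z, ~~ odd (d x y + d y z + d x z);
  dist_geodesic : forall x y m, m <= d x y ->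
    exists p, d x p = m /\ d p y = d x y - m }.

Hypothesis tree : pseudo_tree.
Let dxx := dist_xx tree.
Let dC := distC tree.
Let d4 := dist_four_point tree.
Let dpar := dist_perimeter tree.
Let dgeo := dist_geodesic tree.

Lemma dist_triangle x y z : d x z <= d x y + d y z.
Proof. have := d4 x z y y; rewrite dxx (dC z y); lia. Qed.
Let dtri := dist_triangle.

Lemma dist0_trans x y z : d x y = 0 -> d y z = 0 -> d x z = 0.
Proof. by have := dtri x y z; lia. Qed.

(** The four-point condition bounds [d p q + d x y] by the larger of two sums, and both sums equal
    [d x y]. *)
Lemma geodesic_unique x y p q :
  d x p + d p y = d x y -> d x q + d q y = d x y -> d x p = d x q -> d p q = 0.
Proof.
move=> hp hq e; have := d4 p q x y.
rewrite (dC p x) (dC q x); lia.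
Qed.

Variables (A : zmodType) (act : A -> P -> P).
Hypothesis act0 : forall x, act 0 x = x.
Hypothesis actD : forall a b x, act (a + b)%R x = act a (act b x).
Hypothesis dist_act : forall a x y, d (act a x) (act a y) = d x y.

(** Fixing is meant up to distance 0, because distinct points may represent the same vertex. *)
Definition stab (x : P) (a : A) : Prop := d x (act a x) = 0.

Lemma actC a b x : act a (act b x) = act b (act a x).
Proof. by rewrite -!actD addrC. Qed.

Lemma actKN a x : act a (act (- a)%R x) = x.
Proof. by rewrite -actD subrr act0. Qed.

Lemma stab_diff x a b : d (act a x) (act b x) = 0 -> stab x (b - a)%R.
Proof. by move=> e; rewrite /stab addrC actD -(dist_act a) actKN. Qed.

(** The triangle x, a x, a a x has even perimeter and two sides of equal length. *)
Lemma dist_double_even a x : ~~ odd (d x (act (a + a)%R x)).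
Proof. by have := dpar x (act a x) (act (a + a)%R x); rewrite actD dist_act; lia. Qed.

Lemma min_displacement (x0 : P) a :
  exists x, forall y, d x (act a x) <= d y (act a y).
Proof.
have ex : exists n, `[< exists x, d x (act a x) = n >].
  by exists (d x0 (act a x0)); apply/asboolP; exists x0.
case: (ex_minnP ex) => n /asboolP[x <-] h; exists x => y; apply: h.
by apply/asboolP; exists y.
Qed.

(* If the segments [x, a x] and [a x, a a x] overlapped, the point next to x on
   the first one would be displaced less than x. *)
Lemma min_displacement_axis a x :
  (forall y, d x (act a x) <= d y (act a y)) -> ~~ odd (d x (act a x)) ->
  0 < d x (act a x) -> d x (act a (act a x)) = 2 * d x (act a x).
Proof.
move=> mn ev pos; set o := act a x; set z := act a o.
set D := d x o; have oz : d o z = D by rewrite dist_act.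
apply/eqP; rewrite eqn_leq; apply/andP; split; first by have := dtri x o z; lia.
rewrite leqNgt; apply/negP => lt.
have par := dpar x o z; have ev' : ~~ odd D by [].
have pos' : 0 < D by [].
(* On [x, a x], [p] is next to x and [m] is next to a x. An overlap forces [m] and [act a p] to
   coincide, so that [p] moves by at most D - 2. *)
have [p [xp po]] := @dgeo x o 1 pos'.
have [m [xm mo]] := @dgeo x o D.-1 (leq_pred _).
have oap : d o (act a p) = 1 by rewrite dist_act.
have apz : d (act a p) z = D - 1 by rewrite dist_act.
have mz := d4 m z o x; have map := d4 m (act a p) o z.
have pm := d4 p m x o; have := dtri p m (act a p); have := mn p.
rewrite -/o -/D; move: mz map pm.
rewrite (dC m x) (dC z x) (dC z o) (dC o x) (dC p x) (dC (act a p) o).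
rewrite -/D in po mo xm *.
lia.
Qed.

Section Axis.
Variables (a : A) (D : nat).
Hypothesis D_gt0 : 0 < D.

(** The axis of a hyperbolic [a] of translation length [D]: [x, a x] and [a x, a a x] join without
    backtracking. *)
Definition on_axis x := d x (act a x) = D /\ d x (act a (act a x)) = 2 * D.

Lemma on_axis_act b x : on_axis x -> on_axis (act b x).
Proof. by rewrite /on_axis (actC a b x) (actC a b (act a x)) !dist_act. Qed.

(** A local geodesic is global: the four-point condition on x, a x and the last two translates gives
    the next length from the two before it. *)
Lemma on_axis_iter x n : on_axis x -> d x (act (a *+ n)%R x) = n * D.
Proof.
case=> h1 h2.
suff: d x (act (a *+ n)%R x) = n * D /\ d x (act (a *+ n.+1)%R x) = n.+1 * D.
  by case.
elim: n => [|n [IH1 IH2]]; first by rewrite act0 dxx mulr1n h1 mul1n.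
split=> //; case: n IH1 IH2 => [|n] IH1 IH2.
  by rewrite mulr2n actD h2.
set b := act (a *+ n.+2)%R x; set c := act (a *+ n.+3)%R x.
have e1 : d (act a x) c = n.+2 * D by rewrite /c mulrS actD dist_act.
have e2 : d (act a x) b = n.+1 * D by rewrite /b mulrS actD dist_act.
have e3 : d b c = D by rewrite /b /c (mulrSr a n.+2) (actD (a *+ n.+2)%R) dist_act.
have := d4 x b (act a x) c; have := dtri x b c.
rewrite IH2 e1 e3 h1 (dC b) e2 -/b -/c; nia.
Qed.

(** Induction on n: by the four-point condition y lies on [x, a x] or on the rest of the segment,
    which starts at the axis point a x. *)
Lemma on_segment_axis y n x : on_axis x -> 0 < n ->
  d x y + d y (act (a *+ n)%R x) = n * D ->
  exists i, d (act (a *+ i)%R x) y + d y (act (a *+ i.+1)%R x) = D.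
Proof.
elim: n x => // n IH x ax _ e.
case: n IH e => [|n] IH e; first by exists 0; rewrite act0; lia.
have [h1 h2] := ax.
have i1 := on_axis_iter n.+1 ax; have i2 := on_axis_iter n.+2 ax.
set b := act (a *+ n.+2)%R x in e i2.
have e2 : d (act a x) b = n.+1 * D by rewrite /b mulrS actD dist_act.
have := d4 x b y (act a x); have := d4 y (act a x) x b.
rewrite (dC b) (dC b) (dC y x) (dC y (act a x)) h1 e2 i2 => f1 f2.
have [] : d x y + d y (act a x) = D \/ d (act a x) y + d y b = n.+1 * D.
- have t1 := dtri x y (act a x); have t2 := dtri (act a x) y b.
  rewrite (dC y (act a x)) in t1 f1 f2 *; nia.
- by exists 0; rewrite act0.
rewrite {1}/b mulrSr actD => e'.
have [i ei] := IH _ (on_axis_act a ax) isT e'.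
by exists i.+1; rewrite !mulrSr !actD in ei *.
Qed.

(** Any two axes of [a] agree: once N D exceeds [d x y], the segment from - N a x to N a x contains
    y, and a multiple of [a] moves its piece around y to [x, a x]. *)
Lemma on_axis_translate x y : on_axis x -> on_axis y ->
  exists q : int, d x (act (a *~ q)%R y) + d (act (a *~ q)%R y) (act a x) = D.
Proof.
move=> ax ay; pose N := (d x y).+1.
pose b := (a *+ N)%R.
have e : d (act (- b)%R x) y + d y (act b x) = (N + N) * D.
  rewrite -(dist_act b (act (- b)%R x)) actKN.
  have := d4 x (act b x) y (act b y); have := d4 x (act b y) y (act b x).
  rewrite dist_act (on_axis_iter _ ax) (dC (act b x)) (dC (act b x)) (dC (act b y) y).
  rewrite dist_act (on_axis_iter _ ay) (dC y x).
  have : d x y < N * D by rewrite /N; nia.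
  lia.
have e' : d (act (- b)%R x) y + d y (act (a *+ (N + N))%R (act (- b)%R x))
   = (N + N) * D by rewrite mulrnDr actD actKN e.
have [i ei] := @on_segment_axis y (N + N) _ (on_axis_act (- b)%R ax) isT e'.
exists (N%:Z - i%:Z)%R; rewrite mulrzBr -!pmulrn -/b.
rewrite -(dist_act (b - a *+ i)%R) -[X in _ + X](dist_act (b - a *+ i)%R) in ei.
rewrite -!actD mulrSr in ei.
have e1 : (b - a *+ i + a *+ i - b = 0)%R by rewrite subrK subrr.
have e2 : (b - a *+ i + (a *+ i + a) - b = a)%R.
  by rewrite addrA subrK [(b + a)%R]addrC addrK.
by rewrite e1 e2 act0 in ei.
Qed.

(* The translates of the points [b *+ i] x into the segment [x, a x] cannot be
   all distinct. *)
Lemma on_axis_stab x b : on_axis x ->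
  exists p (q : int), 0 < p /\ stab x (b *+ p + a *~ q)%R.
Proof.
move=> ax.
have /choice[q hq] : forall i, exists q : int,
   d x (act (a *~ q)%R (act (b *+ i)%R x)) +
   d (act (a *~ q)%R (act (b *+ i)%R x)) (act a x) = D.
  by move=> i; apply: on_axis_translate => //; apply: on_axis_act.
pose y i := act (a *~ q i)%R (act (b *+ i)%R x).
have le i : d x (y i) < D.+1 by rewrite ltnS -(hq i) leq_addr.
(* Positions on [x, a x] run from 0 to D, so D + 2 points must collide. *)
pose f (i : 'I_D.+2) : 'I_D.+1 := Ordinal (le i).
have : ~~ injectiveb f.
  apply/injectiveP => /leq_card; rewrite !card_ord; lia.
case/injectivePn => i [j ij /(congr1 val) /= fij].
have coll (i' j' : nat) : (i' < j')%N -> d x (y i') = d x (y j') ->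
    exists p q, 0 < p /\ stab x (b *+ p + a *~ q)%R.
  move=> lt e; exists (j' - i'), (q j' - q i')%R; split; first by lia.
  have /stab_diff : d (act (a *~ q i' + b *+ i')%R x)
                      (act (a *~ q j' + b *+ j')%R x) = 0.
    rewrite !actD; apply: (@geodesic_unique x (act a x)) => //.
    - by rewrite -/(y i') hq; case: ax.
    - by rewrite -/(y j') hq; case: ax.
  rewrite mulrnBr; last lia.
  rewrite mulrzBr; set u := (_ *~ _)%R; set v := (_ *~ _)%R.
  by rewrite [in X in X -> _](addrC u) [in X in X -> _](addrC v) addrACA -opprD.
have : (i < j)%N \/ (j < i)%N by have := ij; rewrite -val_eqE /=; lia.
by case=> lt; [exact: coll lt fij | apply: coll lt (esym fij)].
Qed.

End Axis.

Lemma stab_act x a b : stab x a -> stab (act b x) a.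
Proof. by rewrite /stab actC dist_act. Qed.

(** Fixed point sets are convex: a m has the same position between x and y as m. *)
Lemma stab_of_geodesic x y m a :
  d x m + d m y = d x y -> stab x a -> stab y a -> stab m a.
Proof.
move=> e sx sy; have e1 := dist_act a x m; have e2 := dist_act a m y.
have t1 := dtri x (act a x) (act a m); have t2 := dtri (act a m) (act a y) y.
have t3 := dtri x (act a m) y; rewrite /stab dC in sy.
apply: (@geodesic_unique x y) => //; rewrite /stab in sx; lia.
Qed.

(* The midpoint of [x, a x] is fixed as soon as some point y is: it is the
   projection of x to the set of fixed points. *)
Lemma midpoint_stab x y m a : stab y a -> ~~ odd (d x (act a x)) ->
  d x m = (d x (act a x))./2 -> d x m + d m (act a x) = d x (act a x) -> stab m a.
Proof.
move=> sy ev e1 e2; set z := act a x in e1 e2 ev *.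
have yz : d y z = d y x.
  have := dist_act a y x; have := dtri y (act a y) z.
  have := dtri (act a y) y z; rewrite (dC (act a y) y) sy -/z; lia.
have h1 := d4 y m x z; have h2 := dtri y m x; have h3 := dtri y m z.
have am : d (act a m) z = d m x by rewrite dist_act.
have ay : d y (act a m) = d y m.
  have := dist_act a y m; have := dtri y (act a y) (act a m).
  have := dtri (act a y) y (act a m); rewrite (dC (act a y) y) sy; lia.
apply: (@geodesic_unique y z); rewrite ?ay ?am //;
 rewrite (dC m x) in h1 h2 *; lia.
Qed.

(** A new element a + a replaces the fixed point x by the midpoint of x and its image. The earlier
    elements fix x and, by commutativity, the image, hence also the midpoint. *)
Lemma common_stab (x0 : P) (s : seq A) :
  (forall a, exists x, stab x (a + a)%R) ->
  exists x, forall a, a \in s -> stab x (a + a)%R.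
Proof.
move=> ell; elim: s => [|a s [x hx]]; first by exists x0.
have [y hy] := ell a.
have hl n : n./2 <= n by lia.
have [m [xm mx]] := dgeo (hl (d x (act (a + a)%R x))).
have e : d x m + d m (act (a + a)%R x) = d x (act (a + a)%R x) by lia.
exists m => b; rewrite inE => /predU1P[->|bs].
  by apply: midpoint_stab hy _ xm e; apply: dist_double_even.
by apply: stab_of_geodesic e (hx b bs) _; apply: stab_act (hx b bs).
Qed.

(** Finite lists are enough in the first alternative, as a lattice is finitely generated. In the
    second, [h] is a double without fixed point; its displacements are even, so a point of least
    displacement is on an axis. *)
Theorem abelian_tree_action (x0 : P) :
  (forall s : seq A, exists x, forall a, a \in s -> stab x (a + a)%R) \/
  exists x h, h <> 0%R /\
    forall a, exists p (q : int), 0 < p /\ stab x (a *+ p + h *~ q)%R.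
Proof.
have [ell|] := pselect (forall a, exists x, stab x (a + a)%R).
  by left=> s; apply: common_stab.
move/existsNP => [h nh]; right.
have [x mn] := min_displacement x0 (h + h)%R.
have [D0|D0] := posnP (d x (act (h + h)%R x)); first by case: nh; exists x.
exists x, (h + h)%R; split.
  by move=> e; move: D0; rewrite e act0 dxx.
move=> a; apply: (on_axis_stab D0); split=> //.
by apply: min_displacement_axis => //; apply: dist_double_even.
Qed.

End PseudoTree.

(** * The group of isometries of a distance *)

Section Isometries.
Variables (T : Type) (d : T -> T -> nat).

Record isom := Isom {
  isom_fun :> T -> T;
  isom_inv : T -> T;
  isomK : cancel isom_fun isom_inv;
  isomVK : cancel isom_inv isom_fun;
  dist_isom : forall x y, d (isom_fun x) (isom_fun y) = d x y }.

Lemma isom_ext (f g : isom) : f =1 g -> f = g.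
Proof.
case: f g => [f f' fK f'K df] [g g' gK g'K dg] /= fg.
have {}fg : f = g by exact/funext.
subst g; have f'g' : f' = g'.
  by apply: funext => x; rewrite -{1}[x]g'K fK.
subst g'; congr Isom; exact: Prop_irrelevance.
Qed.

HB.instance Definition _ := gen_eqMixin isom.
HB.instance Definition _ := gen_choiceMixin isom.

Definition isom_one := @Isom id id (fun=> erefl) (fun=> erefl) (fun _ _ => erefl).

Definition isom_mul (f g : isom) : isom.
Proof.
refine (@Isom (f \o g) (isom_inv g \o isom_inv f) _ _ _).
- by move=> x /=; rewrite !isomK.
- by move=> x /=; rewrite !isomVK.
- by move=> x y /=; rewrite !dist_isom.
Defined.

Definition isom_opp (f : isom) : isom.
Proof.
refine (@Isom (isom_inv f) f (@isomVK f) (@isomK f) _).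
by move=> x y; rewrite -(dist_isom f) !isomVK.
Defined.

Lemma isom_mulA : associative isom_mul.
Proof. by move=> f g h; apply: isom_ext. Qed.
Lemma isom_mul1 : left_id isom_one isom_mul.
Proof. by move=> f; apply: isom_ext. Qed.
Lemma isom_mulr1 : right_id isom_one isom_mul.
Proof. by move=> f; apply: isom_ext. Qed.
Lemma isom_mulV : left_inverse isom_one isom_opp isom_mul.
Proof. by move=> f; apply: isom_ext => x /=; rewrite isomK. Qed.
Lemma isom_mulrV : right_inverse isom_one isom_opp isom_mul.
Proof. by move=> f; apply: isom_ext => x /=; rewrite isomVK. Qed.

HB.instance Definition _ := isGroup.Build isom
  isom_mulA isom_mul1 isom_mulr1 isom_mulV isom_mulrV.

Lemma isomM (f g : isom) x : (f * g)%g x = f (g x).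
Proof. by []. Qed.

Lemma isom1 x : (1%g : isom) x = x.
Proof. by []. Qed.

End Isometries.

(** * The rooted tree of finite sequences *)

Section PrefixTree.
Variable L : eqType.
Implicit Types l : seq L.

Fixpoint lcp l1 l2 : nat :=
  match l1, l2 with
  | x :: l1', y :: l2' => if x == y then (lcp l1' l2').+1 else 0
  | _, _ => 0
  end.

(** The path in the tree descends from one sequence to the common prefix and climbs to the other. *)
Definition list_dist l1 l2 := size l1 + size l2 - 2 * lcp l1 l2.

Lemma lcpC l1 l2 : lcp l1 l2 = lcp l2 l1.
Proof. by elim: l1 l2 => [|x l1 IH] [|y l2] //=; rewrite eq_sym IH. Qed.

Lemma lcpxx l : lcp l l = size l.
Proof. by elim: l => //= x l ->; rewrite eqxx. Qed.

Lemma lcp_leql l1 l2 : lcp l1 l2 <= size l1.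
Proof. by elim: l1 l2 => [|x l1 IH] [|y l2] //=; case: eqP => // _; rewrite ltnS IH. Qed.

Lemma lcp_leqr l1 l2 : lcp l1 l2 <= size l2.
Proof. by rewrite lcpC lcp_leql. Qed.

Lemma lcp_ultrametric l1 l2 l3 : minn (lcp l1 l2) (lcp l2 l3) <= lcp l1 l3.
Proof.
elim: l1 l2 l3 => [|x l1 IH] [|y l2] [|z l3] //=; rewrite ?minn0 ?min0n //.
case: (eqVneq x y) => [->|]; last by rewrite min0n.
case: (eqVneq y z) => [_|]; last by rewrite minn0.
by rewrite minnSS ltnS IH.
Qed.

Lemma list_dist_xx l : list_dist l l = 0.
Proof. rewrite /list_dist lcpxx; lia. Qed.

Lemma list_distC l1 l2 : list_dist l1 l2 = list_dist l2 l1.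
Proof. by rewrite /list_dist lcpC addnC. Qed.

(** The lengths cancel, which leaves sums of common prefix lengths to be compared by the ultrametric
    inequality. *)
Lemma list_dist_four_point x y z w :
  list_dist x y + list_dist z w <=
  maxn (list_dist x z + list_dist y w) (list_dist x w + list_dist y z).
Proof.
have u := lcp_ultrametric; have l := lcp_leql; have r := lcp_leqr.
have := u x z y; have := u x w y; have := u z x w; have := u z y w.
have := l x y; have := l z w; have := l x z; have := l y w.
have := l x w; have := l y z; have := r x y; have := r z w.
have := r x z; have := r y w; have := r x w; have := r y z.
rewrite /list_dist (lcpC z x) (lcpC z y) (lcpC w y); lia.
Qed.

Lemma list_dist_perimeter x y z :
  ~~ odd (list_dist x y + list_dist y z + list_dist x z).
Proof.
have l := lcp_leql; have r := lcp_leqr.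
have := l x y; have := l y z; have := l x z.
have := r x y; have := r y z; have := r x z; rewrite /list_dist; lia.
Qed.

Lemma list_dist_nil l : list_dist [::] l = size l.
Proof. by rewrite /list_dist muln0 subn0. Qed.

Lemma list_dist_take m l : list_dist (take m l) l = size l - m.
Proof.
rewrite /list_dist; have -> : lcp (take m l) l = size (take m l).
  by elim: l m => [|x l IH] [|m] //=; rewrite eqxx IH.
rewrite size_take; case: ltnP; lia.
Qed.

Lemma list_dist_cons x l1 l2 : list_dist (x :: l1) (x :: l2) = list_dist l1 l2.
Proof. rewrite /list_dist /= eqxx; lia. Qed.

End PrefixTree.

(** * Normal forms in a multiple HNN extension *)

Section ReducedWords.
Local Open Scope group_scope.
Variables (H : groupType) (E : choiceType) (bar : E -> E).
Variable rho : E -> H -> H -> Prop.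

(* [rho e] is the graph of an isomorphism from the subgroup A_e of H onto
   A_(bar e), inverse to [rho (bar e)]. *)
Record associated_subgroups : Prop := AssociatedSubgroups {
  assoc_barK : involutive bar;
  assoc_bar : forall e k h, rho e k h -> rho (bar e) h k;
  assoc_fun : forall e k h h', rho e k h -> rho e k h' -> h = h';
  assoc_rho1 : forall e, rho e 1 1;
  assoc_rhoM : forall e k h k' h',
    rho e k h -> rho e k' h' -> rho e (k * k') (h * h');
  assoc_rhoV : forall e k h, rho e k h -> rho e k^-1 h^-1 }.

Hypothesis hrho : associated_subgroups.
Let barK := assoc_barK hrho.
Let rho_bar := assoc_bar hrho.
Let rho_fun := assoc_fun hrho.
Let rho1 := assoc_rho1 hrho.
Let rhoM := assoc_rhoM hrho.
Let rhoV := assoc_rhoV hrho.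

Definition assoc e k := `[< exists h, rho e k h >].

Lemma assoc1 e : assoc e 1.
Proof. by apply/asboolP; exists 1. Qed.

Lemma assocM e k k' : assoc e k -> assoc e k' -> assoc e (k * k').
Proof.
move=> /asboolP[h hk] /asboolP[h' hk'].
by apply/asboolP; exists (h * h'); apply: rhoM.
Qed.

Lemma assocV e k : assoc e k -> assoc e k^-1.
Proof. by move=> /asboolP[h hk]; apply/asboolP; exists h^-1; apply: rhoV. Qed.

Lemma assocMl e k x : assoc e k -> assoc e (k * x) = assoc e x.
Proof.
move=> ek; apply/idP/idP => [ekx|]; last exact: assocM.
by rewrite -[x](mulKg k); apply: assocM => //; apply: assocV.
Qed.

Definition phi e k : H :=
  if pselect (exists h, rho e k h) is left p then projT1 (cid p) else 1.

Lemma phiP e k : assoc e k -> rho e k (phi e k).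
Proof. by move=> /asboolP ek; rewrite /phi; case: pselect => // p; case: cid. Qed.

Lemma phiE e k h : rho e k h -> phi e k = h.
Proof.
by move=> kh; apply: (rho_fun _ kh); apply/phiP/asboolP; exists h.
Qed.

Lemma phiM e k k' : assoc e k -> assoc e k' -> phi e (k * k') = phi e k * phi e k'.
Proof. by move=> ek ek'; apply: phiE; apply: rhoM; apply: phiP. Qed.

Lemma phi1 e : phi e 1 = 1.
Proof. exact: phiE. Qed.

Lemma assoc_phi e k : assoc e k -> assoc (bar e) (phi e k).
Proof. by move=> ek; apply/asboolP; exists k; apply/rho_bar/phiP. Qed.

(** A transversal of the cosets x A_e, normalised to 1 on A_e so that a cancelling pair shows as a
    letter with first entry 1. *)
Definition rep e x : H :=
  if assoc e x then 1 else choose (fun y => assoc e (x^-1 * y)) x.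

Lemma rep_assoc e x : assoc e x -> rep e x = 1.
Proof. by rewrite /rep => ->. Qed.

Lemma repP e x : assoc e (x^-1 * rep e x).
Proof.
rewrite /rep; case: ifP => [ex|_]; first by rewrite mulg1 assocV.
by apply: (@chooseP _ (fun y => assoc e (x^-1 * y))); rewrite mulVg assoc1.
Qed.

Lemma repV e x : assoc e ((rep e x)^-1 * x).
Proof. by rewrite -[_ * x]invgK invgM invgK; apply/assocV/repP. Qed.

Lemma rep_coset e x y : assoc e (x^-1 * y) -> rep e x = rep e y.
Proof.
move=> exy; rewrite /rep.
have -> : assoc e y = assoc e x.
  rewrite -[y](mulVKg x); apply/idP/idP => [|ex]; last exact: assocM.
  move=> h; rewrite -[x](mulgK (x^-1 * y)); apply: assocM => //.
  exact: assocV.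
case: ifP => // _.
have yx : (fun z => assoc e (x^-1 * z)) =1 (fun z => assoc e (y^-1 * z)).
  move=> z; rewrite -[z in LHS](mulVKg y) mulgA.
  exact: assocMl.
rewrite (eq_choose yx); apply: choose_id; last by rewrite mulVg assoc1.
by rewrite -yx mulVg assoc1.
Qed.

Lemma rep_eq1 e x : rep e x = 1 -> assoc e x.
Proof. by move=> ex; have := repP e x; rewrite ex mulg1 => /assocV; rewrite invgK. Qed.

Lemma rep_id e x : rep e (rep e x) = rep e x.
Proof. by rewrite -(rep_coset (repP e x)). Qed.

Lemma rep_eq e x y : rep e x = rep e y -> assoc e (x^-1 * y).
Proof.
move=> exy; have := assocM (repP e x) (assocV (repP e y)).
by rewrite invgM invgK exy !mulgA mulgK.
Qed.

(* The word [(s_1, e_1); ...; (s_m, e_m)] stands for the coset of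
   s_1 t_(e_1) ... s_m t_(e_m) modulo H. *)
Definition starts e (l : seq (H * E)) := ohead l == Some (1, e).

(** Britton's condition: t_e is never followed by 1 t_(bar e), and the other entries are coset
    representatives. *)
Fixpoint reduced (l : seq (H * E)) : bool :=
  if l is (s, e) :: l' then
    [&& rep e s == s, ~~ starts (bar e) l' & reduced l']
  else true.

(** Left multiplication by h: write h s = r a with r a representative and a in A_e; then a t_e = t_e
    phi(a) carries phi(a) to the next letter. [hres] is the carry left at the end. *)
Fixpoint hword h (l : seq (H * E)) : seq (H * E) :=
  if l is (s, e) :: l' then
    (rep e (h * s), e) :: hword (phi e ((rep e (h * s))^-1 * (h * s))) l'
  else [::].

Fixpoint hres h (l : seq (H * E)) : H :=
  if l is (s, e) :: l' then hres (phi e ((rep e (h * s))^-1 * (h * s))) l' else h.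

(** At each letter the carry of h h' is the product of the carry of h and that of h'. *)
Lemma hwordM h h' l : hword (h * h') l = hword h (hword h' l) /\
  hres (h * h') l = hres h (hword h' l) * hres h' l.
Proof.
elim: l h h' => [|[s e] l IH] h h' //=.
set s' := rep e (h' * s); have s's : assoc e (s'^-1 * (h' * s)) by apply: repV.
have e1 : rep e (h * h' * s) = rep e (h * s').
  apply/esym/rep_coset; rewrite invgM -!mulgA; congr (assoc e (_ * _)): s's.
  by rewrite mulKg.
rewrite e1; have -> : phi e ((rep e (h * s'))^-1 * (h * h' * s)) =
   phi e ((rep e (h * s'))^-1 * (h * s')) * phi e (s'^-1 * (h' * s)).
  rewrite -phiM //; last exact: repV.
  by congr phi; rewrite -!mulgA mulVKg.
by have [-> ->] := IH (phi e ((rep e (h * s'))^-1 * (h * s'))) (phi e (s'^-1 * (h' * s))).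
Qed.

Lemma hword1 l : reduced l -> hword 1 l = l /\ hres 1 l = 1.
Proof.
elim: l => [|[s e] l IH] //= /and3P[/eqP es _ /IH[]].
by rewrite !mul1g es mulVg phi1 => -> ->.
Qed.

(** The carry behind a letter e lies in A_(bar e); multiplication by it therefore creates no
    cancelling pair. *)
Lemma starts_hword e h l : assoc e h -> reduced l ->
  starts e (hword h l) = starts e l.
Proof.
move=> eh; case: l => [|[s e'] l] //= /and3P[/eqP es _ _].
rewrite /starts /=; apply/eqP/eqP => [[e1 ee]|[e1 ee]]; subst e'; last first.
  by rewrite e1 mulg1 (rep_assoc eh).
by move/rep_eq1: e1; rewrite assocMl // => /rep_assoc; rewrite es => ->.
Qed.

Lemma reduced_hword h l : reduced l -> reduced (hword h l).
Proof.
elim: l h => [|[s e] l IH] h //= /and3P[_ ns rl].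
by rewrite rep_id eqxx IH // andbT starts_hword //; apply/assoc_phi/repV.
Qed.

Lemma size_hword h l : size (hword h l) = size l.
Proof. by elim: l h => [|[s e] l IH] h //=; rewrite IH. Qed.

(** The carry depends only on the letters already read, and the carry permutes the cosets at the
    next letter. *)
Lemma lcp_hword h l1 l2 : reduced l1 -> reduced l2 ->
  lcp (hword h l1) (hword h l2) = lcp l1 l2.
Proof.
elim: l1 l2 h => [|[s e] l1 IH] [|[s2 e2] l2] h //=.
move=> /and3P[/eqP es _ r1] /and3P[/eqP es2 _ r2].
have [[<- <-]|ne] := eqVneq (s, e) (s2, e2); first by rewrite eqxx IH.
case: eqP => // -[e1 ee]; case/eqP: ne; subst e2; congr (_, _).
move/rep_eq: e1; rewrite invgM -!mulgA mulKg => /rep_coset.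
by rewrite es es2.
Qed.

Definition tword e l : seq (H * E) :=
  if starts (bar e) l then behead l else (1, e) :: l.

Lemma reduced_tword e l : reduced l -> reduced (tword e l).
Proof.
rewrite /tword; case: ifPn => [|ns rl]; last first.
  by rewrite /= ns rl rep_assoc ?assoc1 ?eqxx.
by case: l => [|[s e'] l] //= _ /and3P[].
Qed.

Lemma twordK e l : reduced l -> tword (bar e) (tword e l) = l.
Proof.
rewrite /tword; case: (boolP (starts (bar e) l)) => [|ns rl]; last by rewrite /starts barK eqxx.
case: l => [|[s e'] l] // /eqP[-> ->] /= /and3P[_ ns _].
by rewrite (negbTE ns).
Qed.

(** If only one word loses its first letter, neither the old nor the new pair has a common prefix,
    and the other word gains a letter. *)
Lemma list_dist_tword e l1 l2 : reduced l1 -> reduced l2 ->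
  list_dist (tword e l1) (tword e l2) = list_dist l1 l2.
Proof.
have main l l' : starts (bar e) l -> ~~ starts (bar e) l' -> reduced l ->
    list_dist (behead l) ((1, e) :: l') = list_dist l l'.
  case: l => [|[s e'] l] // /eqP[-> ->] ns /= /and3P[_ nl _].
  have -> : list_dist l ((1, e) :: l') = (size l + size l').+1.
    rewrite /list_dist /=; have -> : lcp l ((1, e) :: l') = 0; last by lia.
    case: l nl => [|x l] //=; rewrite /starts barK /=.
    by case: (x =P _) => // ->; rewrite eqxx.
  rewrite /list_dist; have -> : lcp ((1, bar e) :: l) l' = 0; last by simpl; lia.
  case: l' ns => [|x l'] //=; rewrite /starts /=.
  by case: (_ =P x) => // <-; rewrite eqxx.
move=> r1 r2; rewrite /tword; case: ifPn => s1; case: ifPn => s2.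
- case: l1 l2 s1 s2 {r1 r2} => [|x l1] [|y l2] // /eqP[->] /eqP[->].
  by rewrite list_dist_cons.
- exact: main.
- by rewrite list_distC (list_distC l1) main.
- by rewrite list_dist_cons.
Qed.

Lemma tword_hword e k h l : rho e k h -> reduced l ->
  tword e (hword h l) = hword k (tword e l).
Proof.
move=> kh rl; rewrite /tword.
have eh : assoc (bar e) h by apply/asboolP; exists k; apply: rho_bar.
have ek : assoc e k by apply/asboolP; exists h.
rewrite starts_hword //; case: ifPn => [|_].
  case: l rl => [|[s e'] l] //= _ /eqP[-> ->].
  by rewrite mulg1 (rep_assoc eh) invg1 mul1g (phiE (rho_bar kh)).
by rewrite /= mulg1 (rep_assoc ek) invg1 mul1g (phiE kh).
Qed.

Lemma hres_tword e k h l : rho e k h -> reduced l ->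
  hres k (tword e l) = hres h l.
Proof.
move=> kh rl; rewrite /tword.
have eh : assoc (bar e) h by apply/asboolP; exists k; apply: rho_bar.
have ek : assoc e k by apply/asboolP; exists h.
case: ifPn => [|_].
  case: l rl => [|[s e'] l] //= _ /eqP[-> ->].
  by rewrite mulg1 (rep_assoc eh) invg1 mul1g (phiE (rho_bar kh)).
by rewrite /= mulg1 (rep_assoc ek) invg1 mul1g (phiE kh).
Qed.

(** An element of the HNN extension: the word gives its coset modulo H, which is all that
    [nform_dist] sees, and the residue its place in the coset. *)
Record nform := NForm { nword : seq (H * E); nres : H; nformP : reduced nword }.

Lemma nform_ext x y : nword x = nword y -> nres x = nres y -> x = y.
Proof.
case: x y => [l g r] [l' g' r'] /= e1 e2; subst l' g'.
by congr NForm; exact: Prop_irrelevance.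
Qed.

Definition nform_dist x y := list_dist (nword x) (nword y).
Local Notation R := (isom nform_dist).

Definition nf1 : nform := @NForm [::] 1 isT.

Definition hnf h x : nform :=
  NForm (hres h (nword x) * nres x) (reduced_hword h (nformP x)).
Definition tnf e x : nform := NForm (nres x) (reduced_tword e (nformP x)).

Lemma hnfM h h' x : hnf (h * h') x = hnf h (hnf h' x).
Proof.
have [e1 e2] := hwordM h h' (nword x).
by apply: nform_ext => /=; rewrite ?e1 ?e2 ?mulgA.
Qed.

Lemma hnf1 x : hnf 1 x = x.
Proof.
have [e1 e2] := hword1 (nformP x).
by apply: nform_ext => /=; rewrite ?e1 ?e2 ?mul1g.
Qed.

Lemma hnfK h : cancel (hnf h) (hnf h^-1).
Proof. by move=> x; rewrite -hnfM mulVg hnf1. Qed.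

Lemma hnfVK h : cancel (hnf h^-1) (hnf h).
Proof. by move=> x; rewrite -hnfM mulgV hnf1. Qed.

Lemma dist_hnf h x y : nform_dist (hnf h x) (hnf h y) = nform_dist x y.
Proof.
by rewrite /nform_dist /list_dist !size_hword lcp_hword //; apply: nformP.
Qed.

Lemma tnfK e : cancel (tnf e) (tnf (bar e)).
Proof. by move=> x; apply: nform_ext => //=; rewrite twordK ?nformP. Qed.

Lemma tnfVK e : cancel (tnf (bar e)) (tnf e).
Proof. by move=> x; rewrite -[e in tnf e]barK tnfK. Qed.

Lemma dist_tnf e x y : nform_dist (tnf e x) (tnf e y) = nform_dist x y.
Proof. by apply: list_dist_tword; apply: nformP. Qed.

Definition hisom h : R := Isom (hnfK h) (hnfVK h) (dist_hnf h).
Definition tisom e : R := Isom (@tnfK e) (@tnfVK e) (dist_tnf e).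

Lemma hisomM h h' : hisom (h * h') = hisom h * hisom h'.
Proof. by apply: isom_ext => x; apply: hnfM. Qed.

(** The residue of the image of [nf1] recovers h. *)
Lemma hisom_inj : injective hisom.
Proof.
move=> h h' /(congr1 (fun f : R => nres (f nf1))) /=.
by rewrite !mulg1.
Qed.

Lemma tisom_bar e : tisom (bar e) = (tisom e)^-1.
Proof. by apply: isom_ext => x. Qed.

Lemma tisom_conj e k h : rho e k h -> tisom e * hisom h * (tisom e)^-1 = hisom k.
Proof.
move=> kh; suff -> : hisom k = hisom k * tisom e * (tisom e)^-1.
  congr (_ * _); apply: isom_ext => x; apply: nform_ext => /=.
    by apply: tword_hword => //; apply: nformP.
  by rewrite (hres_tword kh (nformP x)).
by rewrite mulgK.
Qed.

End ReducedWords.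

(** * Potentials for group-valued edge labels on a forest *)

Section Potential.
Local Open Scope group_scope.
Variable Gamma : agraph.
Implicit Types (S : {set edge Gamma}) (e : edge Gamma).

Definition reduced_step e e' := (d1 e == d0 e') && (e' != bar e).

(** As vertices do not repeat, the lifted edges do not backtrack. [e0] is the preceding edge, and
    the last hypothesis rules out turning back along it. *)
Lemma reduced_edge_path S x p e0 :
  path (adj S) x p -> uniq (x :: p) -> d1 e0 = x ->
  (bar e0 \in S -> d0 e0 \notin p) ->
  exists q : seq (edge Gamma), [/\ {subset q <= S}, map (@d0 Gamma) q = belast x p,
    path reduced_step e0 q & d1 (last e0 q) = last x p].
Proof.
elim: p x e0 => [|y p IH] x e0 /=; first by move=> _ _ <- _; exists [::].
move=> /andP[/exists_inP[e eS /andP[/eqP ex /eqP ey]] pp] /andP[xp up] e0x back.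
have [|q [qS qb qp ql]] := IH y e pp up ey.
  by move=> _; rewrite ex; move: xp; rewrite inE negb_or => /andP[].
exists (e :: q); split => /=; rewrite ?ex ?qb //.
  by move=> f; rewrite inE => /predU1P[->|/qS].
rewrite qp andbT /reduced_step e0x ex eqxx /=.
apply/negP => /eqP ee; have := back; rewrite -ee eS => /(_ isT).
by rewrite -ey ee /d1 barK mem_head.
Qed.

Variables (G : groupType) (c : edge Gamma -> G).
Hypothesis c_bar : forall e, c (bar e) = (c e)^-1.

(** Removing e and [bar e] separates the ends of e, so a potential on the remaining forest can be
    corrected by a left factor on the component of [d1 e]. *)
Lemma forest_potential S :
  (forall e, e \in S -> bar e \in S) ->
  (forall p, {subset p <= S} -> ~~ circuit p) ->
  exists gam : vertex Gamma -> G,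
    forall e, e \in S -> gam (d1 e) = gam (d0 e) * c e.
Proof.
have [n] := ubnP #|S|; elim: n S => // n IH S leS barS acyc.
have [->|[e eS]] := set_0Vmem S; first by exists (fun=> 1) => e; rewrite inE.
pose S' := S :\ e :\ bar e.
have S'S : {subset S' <= S} by move=> f; rewrite !inE => /and3P[].
have barS' f : f \in S' -> bar f \in S'.
  rewrite !inE => /and3P[fb fe fS]; rewrite barS // andbT.
  rewrite (inj_eq (can_inj (@barK _))) fe /=.
  by apply: contra fb => /eqP<-; rewrite barK.
have [|f fS'|p pS'|gam hgam] := IH S'.
- rewrite -ltnS (leq_trans _ leS) // ltnS; apply: proper_card.
  apply/properP; split; first exact/subsetP.
  by exists e => //; rewrite !inE eqxx andbF.
- exact: barS'.
- by apply: acyc => f /pS'/S'S.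
(* A path from [d1 e] to [d0 e] would close up with e to a circuit. *)
have sep : ~~ connect (adj S') (d1 e) (d0 e).
  apply/negP => /connectP[p pp lp].
  case: (shortenP pp) lp => p' pp' up' _ lp.
  have ne : bar e \notin S' by rewrite !inE eqxx.
  have [|q [qS' qb qp ql]] := reduced_edge_path pp' up' erefl.
    by move=> h; rewrite h in ne.
  have /acyc/negP : {subset e :: q <= S}.
    by move=> f; rewrite inE => /predU1P[->|/qS'/S'S].
  apply.
  rewrite /circuit /= rcons_path qp /= -/(reduced_step _ _) /reduced_step.
  rewrite ql -lp eqxx /= qb; apply/andP; split.
    case: (lastP q) qS' {qb qp ql} => [|q' f] qS' /=; first by rewrite eq_sym bar_neq.
    rewrite last_rcons; apply/eqP => ef; case/negP: ne.
    by rewrite {1}ef barK qS' // mem_rcons mem_head.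
  by have := up'; rewrite lastI rcons_uniq lp.
(* The factor is dictated by the equation at e. *)
pose h := gam (d0 e) * c e * (gam (d1 e))^-1.
exists (fun x => if connect (adj S') (d1 e) x then h * gam x else gam x).
have key f : f \in S' -> connect (adj S') (d1 e) (d1 f) = connect (adj S') (d1 e) (d0 f).
  move=> fS'; have step : connect (adj S') (d0 f) (d1 f).
    by apply/connect1/exists_inP; exists f; rewrite ?eqxx.
  have back : connect (adj S') (d1 f) (d0 f).
    apply/connect1/exists_inP; exists (bar f); rewrite ?barS' //.
    by rewrite /d1 barK !eqxx.
  by apply/idP/idP => /connect_trans; apply.
move=> f fS; have [->|fe] := eqVneq f e.
  by rewrite connect0 (negbTE sep) /h mulgVK.
have [->|fb] := eqVneq f (bar e).
  rewrite /d1 barK -/(d1 e) connect0 (negbTE sep) /h c_bar.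
  by rewrite mulgVK mulgK.
have fS' : f \in S' by rewrite !inE fb fe.
by rewrite key // hgam //; case: ifP => // _; rewrite mulgA.
Qed.

End Potential.

(** * Homomorphisms out of a presented group *)

Section Presentations.
Local Open Scope group_scope.
Local Open Scope quotient_scope.
Variables (X : choiceType) (Rl : word X -> word X -> Prop).
Local Notation pres := (presented Rl).

Definition word_class (w : word X) : pres := \pi_pres w.

Lemma word_class_cat u w : word_class (u ++ w) = word_class u * word_class w.
Proof. by rewrite /word_class -pres_mulE. Qed.

Lemma word_class_winv w : word_class (winv w) = (word_class w)^-1.
Proof. by rewrite /word_class -pres_invE. Qed.

Lemma word_class_nil : word_class [::] = 1.
Proof. by []. Qed.

Lemma word_class_rel u w : Rl u w -> word_class u = word_class w.
Proof. by move=> uw; apply/pres_eqP/PresRel. Qed.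

Variables (G : groupType) (f : X -> G).

Definition word_value (w : word X) : G :=
  foldr (fun a g => (if a.2 then (f a.1)^-1 else f a.1) * g) 1 w.

Hypothesis f_rel : forall u w, Rl u w -> word_value u = word_value w.

Lemma word_value_cat u w : word_value (u ++ w) = word_value u * word_value w.
Proof. by elim: u => [|a u IH] /=; rewrite ?mul1g // IH mulgA. Qed.

Lemma pres_eq_value u w : pres_eq Rl u w -> word_value u = word_value w.
Proof.
elim=> // {u w}.
- by move=> u v w _ -> _ ->.
- by move=> u u' w w' _ e _ e'; rewrite !word_value_cat e e'.
- by move=> x [] /=; rewrite mulg1 ?mulVg ?mulgV.
Qed.

Definition pres_lift (z : pres) : G := word_value (repr z).

Lemma pres_liftE w : pres_lift (word_class w) = word_value w.
Proof. by apply/pres_eq_value/pres_eqP; rewrite reprK. Qed.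

Lemma pres_liftM y z : pres_lift (y * z) = pres_lift y * pres_lift z.
Proof.
rewrite -[y]reprK -[z]reprK -!/(word_class _) -word_class_cat !pres_liftE.
exact: word_value_cat.
Qed.

End Presentations.

(** * Subgroups of integer lattices *)

Section IntegerLattice.
Local Open Scope ring_scope.

Lemma Zn_embeds0 (G : groupType) : Zn_embeds 0 G.
Proof.
exists (fun=> 1%g); split=> [x y _|x y]; last by rewrite mulg1.
by rewrite (thinmx0 x) (thinmx0 y).
Qed.

Lemma row_span_ind k (S : 'rV[int]_k -> Prop) :
  S 0 -> (forall a b, S a -> S b -> S (a + b)) -> (forall a, S a -> S (- a)) ->
  (forall i, S (delta_mx 0 i)) -> forall a, S a.
Proof.
move=> S0 SD SN Sd a; rewrite [a]row_sum_delta; apply: (big_ind S) => // i _.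
have Sn b n : S b -> S (b *+ n).
  by move=> Sb; elim: n => [|n IH]; rewrite ?mulr0n // mulrS; apply: SD.
rewrite -[a 0 i]intz scaler_int; case: (a 0 i) => n; first exact: Sn.
by rewrite NegzE mulrNz; apply/SN/Sn.
Qed.

(* If h_j <> 0, the vectors p_i e_i + q_i h with i <> j are independent. *)
Lemma corank1_embedding k (S : 'rV[int]_k.+1 -> Prop) (h : 'rV[int]_k.+1) :
  S 0 -> (forall a b, S a -> S b -> S (a + b)) -> (forall a, S a -> S (- a)) ->
  h <> 0 -> (forall a, exists p (q : int), (0 < p)%N /\ S (a *+ p + h *~ q)) ->
  exists f : 'rV[int]_k -> 'rV[int]_k.+1,
    [/\ injective f, forall x y, f (x + y) = f x + f y & forall x, S (f x)].
Proof.
move=> S0 SD SN h0 hS.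
have [j hj] : exists j, h 0 j != 0.
  have [j hj|hz] := pickP (fun j => h 0 j != 0); first by exists j.
  by case: h0; apply/rowP => j; rewrite mxE; have /negbFE/eqP := hz j.
have /choice[p /choice[q pq]] := fun i : 'I_k => hS (delta_mx 0 (lift j i)).
pose M : 'M[int]_(k, k.+1) :=
  \matrix_i (delta_mx 0 (lift j i) *+ p i + h *~ q i).
exists (fun x => x *m M); split.
- move=> x y /eqP; rewrite -subr_eq0 -mulmxBl => /eqP; set z := x - y => zM.
  suff : z = 0 by move/eqP; rewrite subr_eq0 => /eqP.
  have ent l : \sum_i z 0 i * ((lift j i == l)%:R *+ p i + h 0 l *~ q i) = 0.
    have : (z *m M) 0 l = 0 by rewrite zM mxE.
    rewrite mxE => e; rewrite -[RHS]e; apply: eq_bigr => i _; congr (_ * _).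
    rewrite [M i l]mxE mxE mulmxnE mxE eqxx /= [l == _]eq_sym.
    by rewrite -scaler_int mxE -mulrzl intz.
  (* Coordinate j sees only the multiples of h, and h_j is nonzero. *)
  have zq : \sum_i z 0 i * q i = 0.
    apply: (mulIf hj); rewrite mul0r mulr_suml -[RHS](ent j).
    apply: eq_bigr => i _; rewrite eq_sym (negbTE (neq_lift j i)) mul0rn add0r.
    by rewrite mulrzz -mulrA [q i * _]mulrC.
  (* Without the h part, coordinate [lift j i] reads z_i p_i = 0. *)
  apply/rowP => i; rewrite [RHS]mxE; apply/eqP.
  have := ent (lift j i); under eq_bigr => l _ do rewrite mulrDr.
  rewrite big_split /= [X in _ + X](_ : _ = 0) ?addr0; last first.
    under eq_bigr => l _ do rewrite mulrzz [_ * q l]mulrC mulrA.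
    by rewrite -mulr_suml zq mul0r.
  rewrite (bigD1 i) //= eqxx big1 => [|l li]; last first.
    by rewrite (inj_eq lift_inj) (negbTE li) mul0rn mulr0.
  have [pi0 _] := pq i.
  by move/eqP; rewrite addr0 mulf_eq0 /= pnatr_eq0 [p i == 0]eqn0Ngt pi0 orbF.
- by move=> x y; rewrite mulmxDl.
- apply: row_span_ind => [|x y|x|i]; rewrite ?mul0mx ?mulmxDl ?mulNmx //; auto.
  by rewrite -rowE rowK; have [] := pq i.
Qed.

End IntegerLattice.

(** * The product of a family of groups *)

Section ProductGroup.
Local Open Scope group_scope.
Variables (I : eqType) (F : I -> groupType).

Definition prodg : Type := forall i, F i.
HB.instance Definition _ := Choice.on prodg.

Definition prodg_one : prodg := fun=> 1.
Definition prodg_mul (x y : prodg) : prodg := fun i => x i * y i.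
Definition prodg_inv (x : prodg) : prodg := fun i => (x i)^-1.

Lemma prodg_mulA : associative prodg_mul.
Proof. by move=> x y z; apply: functional_extensionality_dep => i; apply: mulgA. Qed.
Lemma prodg_mul1 : left_id prodg_one prodg_mul.
Proof. by move=> x; apply: functional_extensionality_dep => i; apply: mul1g. Qed.
Lemma prodg_mulr1 : right_id prodg_one prodg_mul.
Proof. by move=> x; apply: functional_extensionality_dep => i; apply: mulg1. Qed.
Lemma prodg_mulV : left_inverse prodg_one prodg_inv prodg_mul.
Proof. by move=> x; apply: functional_extensionality_dep => i; apply: mulVg. Qed.
Lemma prodg_mulrV : right_inverse prodg_one prodg_inv prodg_mul.
Proof. by move=> x; apply: functional_extensionality_dep => i; apply: mulgV. Qed.

HB.instance Definition _ := isGroup.Build prodg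
  prodg_mulA prodg_mul1 prodg_mulr1 prodg_mulV prodg_mulrV.

Definition iota_prod i (g : F i) : prodg := dfwith prodg_one g.

Lemma iota_prodE i (g : F i) : iota_prod g i = g.
Proof. exact: dfwith_in. Qed.

Lemma iota_prodM i (g h : F i) : iota_prod (g * h) = iota_prod g * iota_prod h.
Proof.
apply: functional_extensionality_dep => j.
rewrite -[RHS]/(iota_prod g j * iota_prod h j) /iota_prod.
have [<-|ij] := eqVneq i j; first by rewrite !dfwith_in.
by rewrite !dfwith_out // /prodg_one mulg1.
Qed.

Lemma iota_prod1 i : iota_prod (1 : F i) = 1.
Proof. by apply: (@mulIg _ (iota_prod (1 : F i))); rewrite -iota_prodM !mul1g. Qed.

Lemma iota_prodV i (g : F i) : iota_prod g^-1 = (iota_prod g)^-1.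
Proof.
by apply: (@mulIg _ (iota_prod g)); rewrite -iota_prodM !mulVg iota_prod1.
Qed.

Lemma iota_prod_inj i : injective (@iota_prod i).
Proof. by move=> g h /(congr1 (fun x : prodg => x i)); rewrite !iota_prodE. Qed.

End ProductGroup.

Lemma morph1 (G K : groupType) (f : G -> K) :
  {morph f : x y / (x * y)%g} -> f 1%g = 1%g.
Proof. by move=> fM; apply: (@mulIg _ (f 1%g)); rewrite -fM !mul1g. Qed.

Lemma morphV (G K : groupType) (f : G -> K) :
  {morph f : x y / (x * y)%g} -> {morph f : x / (x^-1)%g}.
Proof.
by move=> fM x; apply: (@mulIg _ (f x)); rewrite -fM !mulVg morph1.
Qed.

(** * Edge groups inside the product of the vertex groups *)

Section EdgeGroups.
Local Open Scope group_scope.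
Variable GG : graph_of_groups.
Local Notation V := (vertex (ugraph GG)).
Local Notation E := (edge (ugraph GG)).
Local Notation H := (prodg (@vgroup GG)).
Local Notation iota g := (iota_prod g : H).

Lemma ecastM (G K : groupType) (p : G = K) (x y : G) :
  ecast A (A : groupType) p (x * y) =
  ecast A (A : groupType) p x * ecast A (A : groupType) p y.
Proof. by case: K / p. Qed.

Lemma to_barM (e : E) (x y : egroup e) : to_bar (x * y) = to_bar x * to_bar y.
Proof. exact: ecastM. Qed.

(** Comparing inside H avoids a transport between the vertex groups at [d0 e'] and [d0 e]. *)
Lemma emap_cast (e e' : E) (p : egroup e = egroup e') (g : egroup e) :
  e' = e -> iota (emap e' (ecast A (A : groupType) p g)) = iota (emap e g).
Proof. by move=> ee; subst e'; rewrite (Prop_irrelevance p (erefl _)). Qed.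

Lemma to_barK (e : E) (g : egroup e) :
  iota (emap (bar (bar e)) (to_bar (to_bar g))) = iota (emap e g).
Proof.
rewrite -(emap_cast (etrans (egroup_bar e) (egroup_bar (bar e))) g (barK e)).
congr (iota (emap _ _)); rewrite /to_bar.
move: (egroup_bar e) (egroup_bar (bar e)).
move: (egroup (bar e)) (egroup (bar (bar e))) => K L p q.
by case: L / q; case: K / p.
Qed.

(* All vertex groups sit in one group H, the product of them all, so that
   [pi1] can be compared with a multiple HNN extension of H, in which the words
   need not be typed by edge paths. *)
Definition edge_rel (e : E) (k h : H) : Prop :=
  exists g : egroup e, k = iota (emap e g) /\ h = iota (emap (bar e) (to_bar g)).

Lemma edge_rel_associated : associated_subgroups (@bar (ugraph GG)) edge_rel.
Proof.
split.
- exact: barK.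
- by move=> e k h [g [-> ->]]; exists (to_bar g); rewrite to_barK.
- move=> e k h h' [g [-> ->]] [g' [/iota_prod_inj/emap_inj <- ->]] //.
- move=> e; exists 1; rewrite (morph1 (@to_barM e)).
  by rewrite (morph1 (@gmulfM _ _ (emap e))) (morph1 (@gmulfM _ _ (emap (bar e)))) !iota_prod1.
- move=> e k h k' h' [g [-> ->]] [g' [-> ->]]; exists (g * g').
  by rewrite to_barM !gmulfM !iota_prodM.
- move=> e k h [g [-> ->]]; exists g^-1; split.
    by rewrite (morphV (@gmulfM _ _ (emap e))) iota_prodV.
  by rewrite (morphV (@to_barM e)) (morphV (@gmulfM _ _ (emap (bar e)))) iota_prodV.
Qed.

End EdgeGroups.

(** * The fundamental group acting on its Bass-Serre tree *)

Section FundamentalGroupAction.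
Local Open Scope group_scope.
Variables (GG : graph_of_groups) (T : {set edge (ugraph GG)}).
Hypothesis hT : maximal_tree T.
Local Notation V := (vertex (ugraph GG)).
Local Notation E := (edge (ugraph GG)).
Local Notation H := (prodg (@vgroup GG)).
Local Notation iota g := (iota_prod g : H).
Local Notation pi := (pi1 T).
Let hrho := edge_rel_associated GG.
Local Notation NF := (nform (@bar (ugraph GG)) (@edge_rel GG)).
Local Notation R := (isom (@nform_dist _ _ (@bar (ugraph GG)) (@edge_rel GG))).
Local Notation tR e := (tisom hrho e : R).
Local Notation hR h := (hisom hrho h : R).

Definition vcl (v : V) (g : vgroup v) : pi := word_class (pi1_relation T) (wv g).
Definition tcl (e : E) : pi := word_class (pi1_relation T) (wt e).

Lemma vclM v (g h : vgroup v) : vcl (g * h) = vcl g * vcl h.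
Proof. by rewrite /vcl -word_class_cat; apply/esym/word_class_rel/Pi1Mul. Qed.

Lemma vcl1 v : vcl (1 : vgroup v) = 1.
Proof. exact/morph1/vclM. Qed.

Lemma vclV v (g : vgroup v) : vcl g^-1 = (vcl g)^-1.
Proof. exact/morphV/vclM. Qed.

Lemma tcl_bar e : tcl (bar e) = (tcl e)^-1.
Proof.
by rewrite /tcl -word_class_winv; apply/word_class_rel/Pi1Bar.
Qed.

Lemma tcl_conj e (g : egroup e) :
  tcl e * vcl (emap (bar e) (to_bar g)) = vcl (emap e g) * tcl e.
Proof.
apply/(canRL (mulgVK _)); rewrite /tcl /vcl -word_class_winv -!word_class_cat.
by rewrite -catA; apply/word_class_rel/Pi1Conj.
Qed.

Lemma tcl_tree e : e \in T -> tcl e = 1.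
Proof. by move=> eT; apply: word_class_rel; apply: Pi1Tree. Qed.

(** Inverse letters are absorbed by g^-1 and [bar e]. *)
Lemma pi1_ind (Q : pi -> Prop) : Q 1 ->
  (forall v (g : vgroup v) z, Q z -> Q (vcl g * z)) ->
  (forall e z, Q z -> Q (tcl e * z)) -> forall z, Q z.
Proof.
move=> Q1 Qv Qt z; rewrite -[z]reprK -/(word_class _ _).
elim: (repr z) => [|[[[v g]|e] b] w IH]; first by rewrite word_class_nil.
- rewrite -cat1s word_class_cat; case: b; last exact: Qv.
  rewrite -[X in word_class _ X]/(winv (wv g)) word_class_winv -/(vcl g).
  by rewrite -vclV; apply: Qv.
- rewrite -cat1s word_class_cat; case: b; last exact: Qt.
  rewrite -[X in word_class _ X]/(winv (wt e)) word_class_winv -/(tcl e).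
  by rewrite -tcl_bar; apply: Qt.
Qed.

Variable gam : V -> R.
Hypothesis gam_tree : forall e, e \in T -> gam (d1 e) = gam (d0 e) * tR e.

(** Twisting by [gam] moves everything to a common base point and makes the edges of T trivial. *)
Definition gen_isom (x : pi1_gen GG) : R :=
  match x with
  | inl p => gam (tag p) * hR (iota (tagged p)) * (gam (tag p))^-1
  | inr e => gam (d0 e) * tR e * (gam (d1 e))^-1
  end.

Lemma gen_isom_rel u w : pi1_relation T u w ->
  word_value gen_isom u = word_value gen_isom w.
Proof.
case=> [v g h|e|e g|e eT]; rewrite /= ?mulg1.
- by rewrite iota_prodM hisomM !mulgA mulgVK.
- by rewrite tisom_bar !invgM invgK /d1 barK mulgA.
- rewrite !invgM !invgK -/(d1 e).
  have -> : hR (iota (emap e g)) =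
      tR e * hR (iota (emap (bar e) (to_bar g))) * (tR e)^-1.
    by apply/esym/tisom_conj; exists g.
  by rewrite !mulgA !mulgVK.
- by rewrite gam_tree // invgM mulgA mulgK mulgV.
Qed.

Definition Phi : pi -> R := pres_lift gen_isom.

Lemma PhiM y z : Phi (y * z) = Phi y * Phi z.
Proof. exact/pres_liftM/gen_isom_rel. Qed.

Lemma Phi1 : Phi 1 = 1.
Proof. exact/morph1/PhiM. Qed.

Lemma PhiV z : Phi z^-1 = (Phi z)^-1.
Proof. exact/morphV/PhiM. Qed.

Lemma Phi_vcl v (g : vgroup v) : Phi (vcl g) = gam v * hR (iota g) * (gam v)^-1.
Proof. by rewrite /Phi /vcl (pres_liftE gen_isom_rel) /= mulg1. Qed.

Lemma Phi_tcl e : Phi (tcl e) = gam (d0 e) * tR e * (gam (d1 e))^-1.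
Proof. by rewrite /Phi /tcl (pres_liftE gen_isom_rel) /= mulg1. Qed.

(** The vertex groups already act faithfully on the normal forms. *)
Lemma vcl_inj v : injective (@vcl v).
Proof.
move=> g h /(congr1 Phi); rewrite !Phi_vcl => /mulIg/mulgI.
by move/hisom_inj/iota_prod_inj.
Qed.

(* The normal forms that spell a path of the graph of groups from v to w. *)
Fixpoint path_word (v w : V) (l : seq (H * E)) : Prop :=
  if l is (s, e) :: l' then
    [/\ d0 e = v, s = iota (s (d0 e)) & path_word (d1 e) w l']
  else v = w.

Definition path_form v w (x : NF) : Prop :=
  path_word v w (nword x) /\ nres x = iota (nres x w).

Definition word_eval (l : seq (H * E)) : pi :=
  foldr (fun a z => vcl (a.1 (d0 a.2)) * tcl a.2 * z) 1 l.

Definition form_eval w (x : NF) : pi := word_eval (nword x) * vcl (nres x w).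

(** As A_e lies in G_(d0 e), the representative of an element of G_(d0 e) stays in that group, and
    the carry lies in G_(d1 e). *)
Lemma hword_path v w (g : vgroup v) l : path_word v w l ->
  let h := iota g in
  [/\ path_word v w (hword (@edge_rel GG) h l),
      hres (@edge_rel GG) h l = iota (hres (@edge_rel GG) h l w) &
      word_eval (hword (@edge_rel GG) h l) * vcl (hres (@edge_rel GG) h l w) =
      vcl g * word_eval l].
Proof.
elim: l v g => [|[s e] l IH] v g /=.
  by move=> <-; rewrite iota_prodE mul1g mulg1.
case=> ev es pl; subst v; move: es; set g0 := s (d0 e) => es.
rewrite es -iota_prodM.
set x := iota (g * g0); set r := rep (@edge_rel GG) e x.
have [g1 [hg1 _]] := phiP (repP hrho e x).
have [g2 [hg2 hphi]] := phiP (repV hrho e x).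
rewrite -/r in hg1 hg2 hphi.
have er : r = iota (g * g0 * emap e g1) by rewrite iota_prodM -hg1 mulVKg.
rewrite hphi; have [p1 p2 p3] := IH _ (emap (bar e) (to_bar g2)) pl.
split=> //; first by split=> //; rewrite er iota_prodE.
rewrite -mulgA p3 -mulgA [tcl e * _]mulgA tcl_conj !mulgA -!vclM.
congr (vcl _ * _ * _); apply: (@iota_prod_inj _ (@vgroup GG)).
rewrite [LHS]iota_prodM -hg2 -/x; suff -> : iota (r (d0 e)) = r by rewrite mulVKg.
by rewrite er iota_prodE.
Qed.

Lemma hnf_path v w (g : vgroup v) (x : NF) : path_form v w x ->
  path_form v w (hR (iota g) x) /\
  form_eval w (hR (iota g) x) = vcl g * form_eval w x.
Proof.
case=> pw pr; have [h1 h2 h3] := hword_path g pw.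
split; first (split=> //=); rewrite /form_eval /=.
  by rewrite h2 pr -iota_prodM iota_prodE.
by rewrite -[X in vcl X]/(_ w * nres x w) vclM mulgA h3 -mulgA.
Qed.

Lemma tnf_path e w (x : NF) : path_form (d1 e) w x ->
  path_form (d0 e) w (tR e x) /\ form_eval w (tR e x) = tcl e * form_eval w x.
Proof.
case=> pw pr; rewrite /path_form /form_eval /= /tword; case: ifP => st.
  case: x pw pr st => [[|[s e'] l] h rl] //= [_ _ pl] pr /eqP[es ee]; subst e'.
  by rewrite es vcl1 mul1g tcl_bar -!mulgA mulVKg; split; [split=> //; move: pl; rewrite /d1 barK|].
split; last by rewrite /= vcl1 mul1g mulgA.
by split=> //=; split=> //; rewrite iota_prod1.
Qed.

(** Ties the isometry r to z, viewed as a class of paths from v to v' in the fundamental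
    groupoid. *)
Definition translates (z : pi) v v' (r : R) : Prop :=
  forall w x, path_form v' w x ->
    path_form v w (r x) /\ form_eval w (r x) = z * form_eval w x.

Lemma translatesM y z u v w r s :
  translates y u v r -> translates z v w s -> translates (y * z) u w (r * s).
Proof.
move=> hr hs t x /hs[p1 e1]; have [p2 e2] := hr t _ p1.
by rewrite isomM; split; rewrite // e2 e1 mulgA.
Qed.

Lemma translates1 v : translates 1 v v 1.
Proof. by move=> w x px; rewrite isom1 mul1g. Qed.

(** Along a path in T the quotient of potentials telescopes into factors t_e, all trivial in pi. *)
Lemma translates_tree v w : translates 1 v w ((gam v)^-1 * gam w).
Proof.
have [_ conn _] := hT; have /connectP[p pp ->] := conn v w.
elim: p v pp => [|y p IH] v /=; first by rewrite mulVg => _; apply: translates1.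
move=> /andP[/exists_inP[e eT /andP[/eqP <- /eqP <-]] pp].
set u := last _ _; have -> : (gam (d0 e))^-1 * gam u = tR e * ((gam (d1 e))^-1 * gam u).
  by rewrite gam_tree // invgM !mulgA mulgV mul1g.
rewrite -[1]mul1g -{1}(tcl_tree eT); apply: translatesM (IH _ pp).
exact: tnf_path.
Qed.

(** Induction on the generators of z; translations along T, of value 1, lead from v to the vertex
    where the generator starts. *)
Lemma translates_Phi z v w : translates z v w ((gam v)^-1 * Phi z * gam w).
Proof.
have step y y' r a b v' w' : translates y a b r ->
    Phi y = gam a * r * (gam b)^-1 ->
    (forall v w, translates y' v w ((gam v)^-1 * Phi y' * gam w)) ->
    translates (y * y') v' w' ((gam v')^-1 * Phi (y * y') * gam w').
  move=> hr eP hy'.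
  have -> : (gam v')^-1 * Phi (y * y') * gam w' = ((gam v')^-1 * gam a) * (r *
      ((gam b)^-1 * Phi y' * gam w')) by rewrite PhiM eP !mulgA.
  rewrite -[y * y']mul1g; apply: (translatesM (@translates_tree v' a)).
  exact: translatesM hr _.
elim/pi1_ind: z v w => [v w|u g z IH v w|e z IH v w].
- by rewrite Phi1 mulg1; apply: translates_tree.
- by apply: step (Phi_vcl g) IH => t x; apply: hnf_path.
- by apply: step (Phi_tcl e) IH => t x; apply: tnf_path.
Qed.

Local Notation nf1 := (nf1 (@bar (ugraph GG)) (@edge_rel GG)).

(* (x, v) is the vertex x G_v of the Bass-Serre tree. *)
Definition bs_point (p : pi * V) : NF := Phi p.1 (gam p.2 nf1).
Definition bs_dist (p q : pi * V) : nat := nform_dist (bs_point p) (bs_point q).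

(** The normal form of z as a path from v to w. The length of its word is the distance from (1, v)
    to (z, w). *)
Definition bs_form v w z : NF := ((gam v)^-1 * Phi z * gam w) nf1.

(** [nf1] is the empty path at w and evaluates to 1. *)
Lemma bs_form_path v w z :
  path_form v w (bs_form v w z) /\ form_eval w (bs_form v w z) = z.
Proof.
have [|p e] := @translates_Phi z v w w nf1.
  by split=> //=; rewrite iota_prod1.
by split=> //; rewrite e /form_eval /= vcl1 !mulg1.
Qed.

Lemma bs_dist_translate x v p q :
  bs_dist p q = nform_dist (bs_form v p.2 (x^-1 * p.1)) (bs_form v q.2 (x^-1 * q.1)).
Proof.
rewrite /bs_dist -(dist_isom ((gam v)^-1 * (Phi x)^-1)) /bs_point /bs_form.
by rewrite -!isomM !PhiM PhiV !mulgA.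
Qed.

Lemma bs_distE x v q :
  bs_dist (x, v) q = nform_dist nf1 (bs_form v q.2 (x^-1 * q.1)).
Proof.
by rewrite (bs_dist_translate x v) /= mulVg /bs_form Phi1 mulg1 mulVg isom1.
Qed.

Lemma bs_dist_act z x v y w :
  bs_dist (z * x, v) (z * y, w) = bs_dist (x, v) (y, w).
Proof. by rewrite !bs_distE /= invgM -!mulgA mulKg. Qed.

(** Every reduced path word is the word of a vertex; its prefixes will supply the intermediate
    points of geodesics. *)
Lemma Phi_word_eval v w l (rl : reduced (@bar (ugraph GG)) (@edge_rel GG) l) :
  path_word v w l ->
  Phi (word_eval l) (gam w nf1) = gam v (NForm 1 rl).
Proof.
elim: l v rl => [|[s e] l IH] v rl /=.
  by move=> <-; rewrite Phi1 isom1; congr (gam v _); apply: nform_ext.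
case=> ev es pl; subst v; have /= /and3P[/eqP rs ns rl'] := rl.
rewrite !PhiM Phi_vcl Phi_tcl !isomM (IH _ rl' pl) -!isomM -es.
rewrite !mulgVK -mulgA isomM; congr (gam _ _).
apply: nform_ext; rewrite /= /tword (negbTE ns) /= !mulg1 rs mulVg (phi1 hrho).
  by have [-> _] := hword1 hrho rl'.
by have [_ ->] := hword1 hrho rl'.
Qed.

Lemma reduced_take m l : reduced (@bar (ugraph GG)) (@edge_rel GG) l ->
  reduced (@bar (ugraph GG)) (@edge_rel GG) (take m l).
Proof.
elim: l m => [|[s e] l IH] [|m] //= /and3P[-> ns rl]; rewrite IH //= andbT.
by case: l ns {IH rl} => [|a l]; case: m.
Qed.

Lemma path_word_take m v w l : path_word v w l ->
  exists u, path_word v u (take m l).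
Proof.
elim: l m v => [|[s e] l IH] [|m] v /=; try by exists v.
by case=> ev es /(IH m)[u pu]; exists u.
Qed.

(** All but the last clause hold for any sequences. For geodesics, the root is moved to (x, v) and
    prefixes are taken of the word of (y, w). *)
Lemma bs_tree : pseudo_tree bs_dist.
Proof.
split=> [p|p q|p q r s|p q r|[x v] [y w] m].
- exact: list_dist_xx.
- exact: list_distC.
- exact: list_dist_four_point.
- exact: list_dist_perimeter.
set z := bs_form v w (x^-1 * y); have [[pw _] _] := bs_form_path v w (x^-1 * y).
rewrite bs_distE -/z => le_m; have [u pu] := path_word_take m pw.
have rt := reduced_take m (nformP z).
have e : bs_form v u (word_eval (take m (nword z))) = NForm 1 rt.
  by rewrite /bs_form -mulgA !isomM (Phi_word_eval rt pu) -isomM mulVg.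
exists (x * word_eval (take m (nword z)), u); split.
  rewrite bs_distE /= mulKg e /nform_dist /= list_dist_nil size_take_min.
  by apply/minn_idPl; rewrite -(list_dist_nil (nword z)).
rewrite (bs_dist_translate x v) /= mulKg e /nform_dist /=.
by rewrite list_dist_take list_dist_nil.
Qed.

(** At distance 0 the word is empty, and the residue is an element of G_v. *)
Lemma bs_stab x v z : bs_dist (x, v) (z * x, v) = 0%N ->
  exists g : vgroup v, vcl g = x^-1 * z * x.
Proof.
rewrite bs_distE /= mulgA /nform_dist list_dist_nil => /size0nil e.
have [_ ev] := bs_form_path v v (x^-1 * z * x).
by exists (nres (bs_form v v (x^-1 * z * x)) v); rewrite -[RHS]ev /form_eval e mul1g.
Qed.

Lemma Zn_embeds_vertex k (f : 'rV[int]_k -> pi) x v :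
  injective f -> (forall a b, f (a + b)%R = f a * f b) ->
  (forall a, bs_dist (x, v) (f a * x, v) = 0%N) -> Zn_embeds k (vgroup v).
Proof.
move=> f_inj fD st; have /choice[g hg] := fun a => bs_stab (st a).
exists g; split=> [a b /(congr1 (@vcl v))|a b].
  by rewrite !hg => /mulIg/mulgI/f_inj.
by apply: vcl_inj; rewrite vclM !hg fD !mulgA mulgK.
Qed.

(** For k > 0, [j] is k when there is a common fixed vertex and k - 1 when there is an axis. *)
Lemma Zn_embeds_pi1 (v0 : V) k : Zn_embeds k pi ->
  exists (v : V) j, (k <= j.+1)%N /\ Zn_embeds j (vgroup v).
Proof.
case: k => [_|k [f [f_inj fD]]]; first by exists v0, 0%N; split=> //; apply: Zn_embeds0.
have f0 : f 0%R = 1 by apply: (@mulIg _ (f 0%R)); rewrite -fD addr0 mul1g.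
pose act a (p : pi * V) := (f a * p.1, p.2).
have act0 p : act 0%R p = p by case: p => x v; rewrite /act f0 mul1g.
have actD a b p : act (a + b)%R p = act a (act b p) by rewrite /act fD mulgA.
have dist_act a p q : bs_dist (act a p) (act a q) = bs_dist p q.
  by case: p q => [x v] [y w]; rewrite /act bs_dist_act.
have stab_subgroup p : [/\ stab bs_dist act p 0%R,
    forall a b, stab bs_dist act p a -> stab bs_dist act p b ->
      stab bs_dist act p (a + b)%R &
    forall a, stab bs_dist act p a -> stab bs_dist act p (- a)%R].
  split=> [|a b Sa Sb|a Sa]; rewrite /stab.
  - by rewrite act0 (dist_xx bs_tree).
  - apply: (dist0_trans bs_tree (y := act a p)) => //.
    by rewrite actD dist_act.
  - by rewrite -(dist_act a) -actD subrr act0 (distC bs_tree).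
have [ell|] := abelian_tree_action bs_tree act0 actD dist_act (1, v0).
  (* If the doubles of the basis vectors fix the vertex, all doubles do, and a -> a + a is
     injective. *)
  have [[x v] fix_x] := ell [seq delta_mx 0%R i | i <- enum 'I_k.+1].
  exists v, k.+1; split=> //; apply: (@Zn_embeds_vertex _ (fun a => f (a + a)%R) x).
  - move=> a b /f_inj /rowP ab; apply/rowP => i; have := ab i; rewrite !mxE.
    by move: (a _ _) (b _ _) => r s; lia.
  - by move=> a b; rewrite -fD addrACA.
  have [S0 SD SN] := stab_subgroup (x, v).
  apply: row_span_ind => [|a b Sa Sb|a Sa|i].
  - by rewrite addr0.
  - by rewrite addrACA; apply: SD.
  - by rewrite -opprD; apply: SN.
  - by apply/fix_x/map_f; rewrite mem_enum.
case=> [[x v] [h [h0 hS]]].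
have [S0 SD SN] := stab_subgroup (x, v).
have [g [g_inj gD gS]] := corank1_embedding S0 SD SN h0 hS.
exists v, k; split=> //; apply: (@Zn_embeds_vertex k (f \o g) x).
- by move=> a b /f_inj/g_inj.
- by move=> a b /=; rewrite gD fD.
- exact: gS.
Qed.

End FundamentalGroupAction.

(** * Existence and bound of the rank of the fundamental group *)

Theorem theorem2 (n : nat) (GG : graph_of_groups)
    (hconn : connected_graph (ugraph GG))
    (hrank : forall v : vertex (ugraph GG),
       exists2 r : nat, geometric_rank (vgroup v) r & (r <= n)%N)
    (T : {set edge (ugraph GG)}) (hT : maximal_tree T) :
  exists2 r : nat, geometric_rank (pi1 T) r & (r <= n.+1)%N.
Proof.
have [V0 _] := hconn; have [v0 _] := card_gt0P V0.
have [barT _ acyc] := hT.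
have [gam gam_tree] := forest_potential (tisom_bar (edge_rel_associated GG)) barT acyc.
have bound k : Zn_embeds k (pi1 T) -> (k <= n.+1)%N.
  move=> /(Zn_embeds_pi1 hT gam_tree v0)[v [j [kj jv]]].
  have [r [_ rmax] rn] := hrank v.
  by apply: leq_trans kj _; rewrite ltnS (leq_trans (rmax _ jv)).
(* The rank is the maximum of a bounded set of exponents containing 0. *)
have ex : exists k, `[< Zn_embeds k (pi1 T) >].
  by exists 0%N; apply/asboolP/Zn_embeds0.
have ub k : `[< Zn_embeds k (pi1 T) >] -> (k <= n.+1)%N.
  by move=> /asboolP/bound.
case: (ex_maxnP ex ub) => r /asboolP hr rmax.
by exists r; [split=> // k hk; apply/rmax/asboolP | exact: bound].
Qed.
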